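(* Let $R_q(k,s)$ be the number of solutions $(Y_1,Z_1,U_1,V_1,\ldots,Y_q,Z_q,U_q,V_q)$ in $\mathbb{F}_2[T]$ of \[\begin{cases} Y_1Z_1+\cdots+Y_qZ_q=0,\\ Y_1U_1+\cdots+Y_qU_q=0,\\ Y_1V_1+\cdots+Y_qV_q=0,\end{cases}\] with $\deg Y_i\leq k-1$, $\deg Z_i\leq s-1$, $\deg U_i\leq s-1$, $\deg V_i\leq s-1$ for $1\leq i\leq q$. Then $$R_q(k,s) = \int_{\mathbb{P}\times\mathbb{P}\times\mathbb{P}} g_{k,s}^{q}(t,\eta,\xi)\,dt\,d\eta\,d\xi = 2^{(3s+k)q}\cdot 2^{-3k-3s+3}\cdot\sum_{i=0}^{\inf(3s,k)}\Gamma_{i}^{\left[s\atop{s\atop s}\right]\times k}\cdot 2^{-qi}.$$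
   Context: $\mathbb{K}=\mathbb{F}_2((T^{-1}))$, $\mathbb{P}$ its unit interval with normalized Haar measure, $E$ the additive character of $\mathbb{K}$ ($E(\sum a_iT^i)=(-1)^{a_{-1}}$), and $g_{k,s}(t,\eta,\xi)=\sum_{\deg Y\leq k-1}\sum_{\deg Z\leq s-1}E(tYZ)\sum_{\deg U\leq s-1}E(\eta YU)\sum_{\deg V\leq s-1}E(\xi YV)$. $\Gamma_{i}^{\left[s\atop{s\atop s}\right]\times k}$ is the number of rank $i$ matrices $\left[\frac{A}{\frac{B}{C}}\right]$ over $\mathbb{F}_2$ with $A,B,C$ all $s\times k$ persymmetric matrices. *)

(* Defs.v *)
From HB Require Import structures.
From mathcomp Require Import all_boot all_order all_algebra.
From mathcomp Require Import all_classical all_reals all_analysis.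
From mathcomp Require Import zify.

Set Implicit Arguments.
Unset Strict Implicit.
Unset Printing Implicit Defensive.

Import Order.TTheory GRing.Theory Num.Theory.
Local Open Scope classical_set_scope.
Local Open Scope ring_scope.

(* The formal series sum_i a_i T^i, i in Z, whose degree is at most n. *)
Definition deg_le (a : int -> 'F_2) (n : int) : Prop :=
  forall i, n < i -> a i = 0.

(* F_2((T^-1)): a series may have infinitely many negative powers of T, but
   only finitely many positive ones. *)
Record laurent := Laurent {
  lcoef :> int -> 'F_2;
  laurentP : exists n, deg_le lcoef n }.

Lemma laurent_ext (x y : laurent) : (forall i, x i = y i) -> x = y.
Proof.
case: x y => [a ha] [b hb] /= /funext ab.
by move: ha hb; rewrite ab => ha hb; rewrite (Prop_irrelevance ha hb).
Qed.

HB.instance Definition _ := gen_eqMixin laurent.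
HB.instance Definition _ := gen_choiceMixin laurent.

Fact zerol_subproof : exists n, deg_le (fun=> 0) n.
Proof. by exists 0. Qed.
Definition zerol := Laurent zerol_subproof.

Fact onel_subproof : exists n, deg_le (fun i => (i == 0)%:R) n.
Proof. by exists 0 => i i0; rewrite gt_eqF. Qed.
Definition onel := Laurent onel_subproof.

Fact addl_subproof (x y : laurent) : exists n, deg_le (fun i => x i + y i) n.
Proof.
have [[n xn] [m ym]] := (laurentP x, laurentP y).
by exists (Num.max n m) => i; rewrite gt_max => /andP[/xn-> /ym->]; rewrite addr0.
Qed.
Definition addl x y := Laurent (addl_subproof x y).

Fact oppl_subproof (x : laurent) : exists n, deg_le (fun i => - x i) n.
Proof. by have [n xn] := laurentP x; exists n => i /xn->; rewrite oppr0. Qed.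
Definition oppl x := Laurent (oppl_subproof x).

(* The sum has finitely many nonzero terms, as x and y have bounded degree. *)
Definition convl (x y : int -> 'F_2) (n : int) : 'F_2 :=
  \sum_(i \in [set: int]) x i * y (n - i).

Fact mull_subproof (x y : laurent) : exists n, deg_le (convl x y) n.
Proof.
have [[n xn] [m ym]] := (laurentP x, laurentP y).
exists (n + m) => i nmi; apply: fsbig1 => j _.
have [/xn->|jn] := ltP n j; first by rewrite mul0r.
by rewrite ym ?mulr0 //; lia.
Qed.
Definition mull x y := Laurent (mull_subproof x y).

Lemma finite_itv_int (m M : int) : finite_set [set i : int | m <= i <= M].
Proof.
apply: (@sub_finite_set _ _ ((fun k : nat => m + k%:Z) @` `I_(absz (M - m)).+1)).
  move=> i /= miM; exists (absz (i - m)); lia.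
exact/finite_image/finite_II.
Qed.

Lemma fsum_itv_int (F : int -> 'F_2) (m M : int) :
  (forall i, F i != 0 -> m <= i <= M) ->
  \sum_(i \in [set: int]) F i = \sum_(i \in [set i | m <= i <= M]) F i.
Proof.
move=> Fm; apply/esym/fsbig_widen => // i /= [_ /negP imM].
by apply/eqP; apply: contraNT imM => /Fm.
Qed.

Lemma addlA : associative addl.
Proof. by move=> x y z; apply: laurent_ext => i /=; rewrite addrA. Qed.
Lemma addlC : commutative addl.
Proof. by move=> x y; apply: laurent_ext => i /=; rewrite addrC. Qed.
Lemma add0l : left_id zerol addl.
Proof. by move=> x; apply: laurent_ext => i /=; rewrite add0r. Qed.
Lemma addNl : left_inverse zerol oppl addl.
Proof. by move=> x; apply: laurent_ext => i /=; rewrite addNr. Qed.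

HB.instance Definition _ := GRing.isZmodule.Build laurent addlA addlC add0l addNl.

Lemma convl_itv (x y : int -> 'F_2) a b n m M : deg_le x a -> deg_le y b ->
  m <= n - b -> a <= M ->
  convl x y n = \sum_(i \in [set i | m <= i <= M]) x i * y (n - i).
Proof.
move=> xa yb hm hM; apply: fsum_itv_int => i; apply: contra_neqT => imM.
have [/xa->|ia] := ltP a i; first by rewrite mul0r.
by rewrite yb ?mulr0 //; lia.
Qed.

Lemma mullC : commutative mull.
Proof.
move=> x y; apply: laurent_ext => n /=; rewrite /convl.
rewrite (reindex_fsbigT (fun i : int => n - i)) /=.
  by apply: eq_fsbigr => i _; rewrite mulrC subKr.
by exists (fun i : int => n - i) => i; lia.
Qed.

Lemma mul1l : left_id onel mull.
Proof.
move=> x; apply: laurent_ext => n /=; rewrite /convl.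
have -> : (\sum_(i \in [set: int]) (i == 0)%:R * x (n - i) =
  \sum_(i \in [set (0 : int)]) (i == 0)%:R * x (n - i) :> 'F_2)%R.
  apply/esym/fsbig_widen => // i /= [_ /eqP i0].
  by rewrite (negbTE i0) mul0r.
by rewrite fsbig_set1 eqxx mul1r subr0.
Qed.

Lemma mullDl : left_distributive mull addl.
Proof.
move=> x y z; apply: laurent_ext => n /=.
have [[a xa] [b yb]] := (laurentP x, laurentP y); have [c zc] := laurentP z.
have xyab : deg_le (addl x y) (Num.max a b).
  by move=> i; rewrite gt_max /= => /andP[/xa-> /yb->]; rewrite addr0.
rewrite (convl_itv (m := n - c) (M := Num.max a b) xyab zc) //.
rewrite (convl_itv (m := n - c) (M := Num.max a b) xa zc) ?le_max ?lexx //.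
rewrite (convl_itv (m := n - c) (M := Num.max a b) yb zc) ?le_max ?lexx ?orbT //.
rewrite -fsbig_split /=; last exact: finite_itv_int.
by apply: eq_fsbigr => i _; rewrite mulrDl.
Qed.

Lemma mullA : associative mull.
Proof.
move=> x y z; apply: laurent_ext => n /=.
have [[a xa] [b yb]] := (laurentP x, laurentP y); have [c zc] := laurentP z.
have yzbc : deg_le (convl y z) (b + c).
  move=> i bci; apply: fsbig1 => j _.
  have [/yb->|jb] := ltP b j; first by rewrite mul0r.
  by rewrite zc ?mulr0 //; lia.
have xyab : deg_le (convl x y) (a + b).
  move=> i bci; apply: fsbig1 => j _.
  have [/xa->|jb] := ltP a j; first by rewrite mul0r.
  by rewrite yb ?mulr0 //; lia.
rewrite (convl_itv (m := n - b - c) (M := a) xa yzbc) //; last by lia.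
rewrite (convl_itv (m := n - c) (M := a + b) xyab zc) //.
transitivity (\sum_(j \in [set j | n - b - c <= j <= a])
  \sum_(i \in [set i | n - c <= i <= a + b]) x j * (y (i - j) * z (n - i)) : 'F_2).
  apply: eq_fsbigr => j; rewrite inE /= => /andP[_ ja].
  rewrite -mulr_fsumr; congr (_ * _).
  rewrite /convl (reindex_fsbigT (fun i : int => i - j)) /=; last first.
    by exists (fun i : int => i + j) => i; lia.
  rewrite (@fsum_itv_int _ (n - c) (a + b)) => [|i].
    by apply: eq_fsbigr => i _; congr (_ * z _); lia.
  apply: contra_neqT => imM.
  have [/yb->|ib] := ltP b (i - j); first by rewrite mul0r.
  by rewrite zc ?mulr0 //; lia.
rewrite exchange_fsbig; [|exact: finite_itv_int..].
apply: eq_fsbigr => i; rewrite inE /= => /andP[ni _].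
rewrite (convl_itv (m := n - b - c) (M := a) xa yb) //; last by lia.
by rewrite mulr_fsuml; apply: eq_fsbigr => j _; rewrite mulrA.
Qed.

Lemma onel_neq0 : onel != 0 :> laurent.
Proof. by apply/eqP => /(congr1 (fun x : laurent => x 0)) /eqP. Qed.

HB.instance Definition _ :=
  GRing.Zmodule_isComNzRing.Build laurent mullA mullC mul1l mullDl onel_neq0.

Fact laurent_of_poly_subproof (p : {poly 'F_2}) :
  exists n, deg_le (fun i => if i is Posz j then p`_j else 0) n.
Proof.
exists (size p)%:Z => -[j|//] pj.
by rewrite nth_default // ltnW // -ltz_nat.
Qed.
Definition laurent_of_poly (p : {poly 'F_2}) := Laurent (laurent_of_poly_subproof p).

Notation "p %:L" := (laurent_of_poly p) (at level 2, format "p %:L") : ring_scope.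

(* The topology of the absolute value |x| = 2 ^ deg x; the balls centered at x
   are the sets of the y such that deg (y - x) <= n. *)
Definition laurent_open (U : set laurent) : Prop :=
  forall x, U x -> exists n, forall y : laurent, deg_le (y - x) n -> U y.

Lemma laurent_openT : laurent_open setT.
Proof. by move=> x _; exists 0. Qed.

Lemma laurent_openI U V : laurent_open U -> laurent_open V -> laurent_open (U `&` V).
Proof.
move=> oU oV x [/oU[n Un] /oV[m Vm]]; exists (Num.min n m) => y yx.
by split; [apply: Un|apply: Vm] => i ni; apply: yx; rewrite gt_min ni ?orbT.
Qed.

Lemma laurent_open_bigU (I : Type) (f : I -> set laurent) :
  (forall i, laurent_open (f i)) -> laurent_open (\bigcup_i f i).
Proof. by move=> of_ x [i _ /of_[n fn]]; exists n => y /fn; exists i. Qed.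

HB.instance Definition _ := isPointed.Build laurent 0.
HB.instance Definition _ := isOpenTopological.Build laurent
  laurent_openT laurent_openI laurent_open_bigU.

HB.instance Definition _ := @isMeasurable.Build (sigma_display (@open laurent)) laurent
  <<s (@open laurent) >> (@sigma_algebra0 _ setT (@open laurent))
  (@sigma_algebraC _ (@open laurent)) (@sigma_algebra_bigcup _ setT (@open laurent)).

(* |x| < 1 *)
Definition unit_itv : set laurent := [set x : laurent | deg_le x (-1)].

Section haar.
Variable R : realType.

Definition normalized_haar (mu : set laurent -> \bar R) : Prop :=
  (forall (x : laurent) (A : set laurent), measurable A ->
     mu ((fun y => x + y) @` A) = mu A) /\ mu unit_itv = 1%E.

Definition charE (x : laurent) : R := (-1) ^+ (x (-1) : nat).

Definition g (k s : nat) (t eta xi : laurent) : R :=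
  \sum_(Y : {poly_k 'F_2}) \sum_(Z : {poly_s 'F_2}) charE (t * Y%:L * Z%:L) *
    (\sum_(U : {poly_s 'F_2}) charE (eta * Y%:L * U%:L) *
      (\sum_(V : {poly_s 'F_2}) charE (xi * Y%:L * V%:L))).

End haar.

(* Constant along antidiagonals (Hankel). *)
Definition persymmetric (m n : nat) (A : 'M['F_2]_(m, n)) : bool :=
  [forall i : 'I_m, forall j : 'I_n, forall i' : 'I_m, forall j' : 'I_n,
    (i + j == i' + j')%N ==> (A i j == A i' j')].

(* The three s x k blocks of M, from top to bottom, are usubmx M,
   usubmx (dsubmx M) and dsubmx (dsubmx M). *)
Definition Gamma (s k i : nat) : nat :=
  #|[pred M : 'M['F_2]_(s + (s + s), k) |
      [&& persymmetric (usubmx M), persymmetric (usubmx (dsubmx M)),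
          persymmetric (dsubmx (dsubmx M)) & \rank M == i]]|.

(* {poly_n 'F_2} is the type of the polynomials of degree at most n - 1,
   0 included. *)
Definition num_solutions (q k s : nat) : nat :=
  #|[pred x : {ffun 'I_q -> {poly_k 'F_2}} * {ffun 'I_q -> {poly_s 'F_2}} *
              {ffun 'I_q -> {poly_s 'F_2}} * {ffun 'I_q -> {poly_s 'F_2}} |
      let: (Y, Z, U, V) := x in
      [&& \sum_i (Y i : {poly 'F_2}) * Z i == 0,
          \sum_i (Y i : {poly 'F_2}) * U i == 0 &
          \sum_i (Y i : {poly 'F_2}) * V i == 0]]|.

(* Main.v *)
(** Let N = k + s - 1. Summing over Z, U and V first, E kills every Y except those in the
    kernel of the three stacked s x k Hankel matrices built on the coefficients of T^-1,
    ..., T^-N in t, eta and xi. Hence g(t, eta, xi) = 2^(3s + k - r), where r is the rank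
    of the stack, so that g is constant on the products of three cosets of the ball
    {deg x < -N}. By translation invariance each of the 2^N cosets filling the unit
    interval has measure 2^-N, and the integral of g^q is 2^(-3N) times the sum of g^q
    over triples (a, b, c) of representatives. This finite sum is evaluated in two ways.
    - Hankel stacks correspond to triples (a, b, c) one to one: grouping the triples by
      rank gives the sum over Gamma.
    - Expanding the power, g^q is the sum, over the q-tuples Y, of the product of the
      three sums over q-tuples W of E(t <Y, W>), E(eta <Y, W>) and E(xi <Y, W>).
      The coefficient of T^-1 in a P is symmetric in the coefficients of a and P, so
      orthogonality of characters also applies to the sum over a, and turns each factor
      into 2^N n(Y), with n(Y) the number of W such that <Y, W> = 0. The number of
      solutions is the sum of n(Y)^3. *)

Require Import Defs.
From HB Require Import structures.
From mathcomp Require Import all_boot all_order all_algebra.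
From mathcomp Require Import mxabelem.
From mathcomp Require Import all_classical all_reals all_analysis.
From mathcomp Require Import measurable_realfun zify ring.

Set Implicit Arguments.
Unset Strict Implicit.
Unset Printing Implicit Defensive.

Import Order.TTheory GRing.Theory Num.Theory.
Local Open Scope classical_set_scope.
Local Open Scope ring_scope.

Lemma big_distr_triple (R : pzSemiRingType) (I J K : finType)
    (f : I -> R) (g : J -> R) (h : K -> R) :
  (\sum_i f i) * (\sum_j g j) * (\sum_k h k) =
  \sum_(x : I * J * K) f x.1.1 * g x.1.2 * h x.2.
Proof. by rewrite big_distrlr pair_bigA big_distrlr pair_bigA. Qed.

Lemma partition_big_nat (R : pzSemiRingType) (I : finType) (P : pred I)
    (h : I -> nat) (n : nat) (f : nat -> R) :
  (forall i, P i -> h i < n)%N ->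
  \sum_(i | P i) f (h i) =
  \sum_(0 <= j < n) #|[pred i | P i & h i == j]|%:R * f j.
Proof.
move=> hn; rewrite big_mkord.
under [RHS]eq_bigr => j _.
  rewrite -sum1_card natr_sum mulr_suml.
  under eq_bigr => i /andP[_ /eqP <-] do rewrite mul1r.
  over.
rewrite (exchange_big_dep P) /= => [|j i _ /andP[]//].
apply: eq_bigr => i Pi; rewrite (big_pred1 (Ordinal (hn i Pi))) // => j.
by rewrite /= inE Pi eq_sym.
Qed.

Lemma sum_character (V : finZmodType) (R : idomainType) (chi : V -> R) :
  {morph chi : u v / u + v >-> u * v} ->
  \sum_v chi v = #|V|%:R * [forall v, chi v == 1]%:R.
Proof.
move=> chiD; have [/forallP chi1|/forallPn[u chiu]] := boolP [forall v, chi v == 1].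
  by rewrite mulr1 -sumr_const; apply: eq_bigr => v _; apply/eqP/chi1.
suff /eqP : (1 - chi u) * \sum_v chi v = 0.
  by rewrite mulf_eq0 subr_eq0 eq_sym (negbTE chiu) mulr0 => /eqP.
rewrite mulrBl mul1r [X in X - _](reindex_inj (addrI u)) mulr_sumr.
by apply/eqP; rewrite subr_eq0; apply/eqP/eq_bigr => v _; rewrite chiD.
Qed.

Lemma card_npoly_kernel (F : finFieldType) (m k : nat) (M : 'M[F]_(m, k)) :
  #|[pred Y : {poly_k F} | M *m (npoly_rV Y)^T == 0]| = (#|F| ^ (k - \rank M))%N.
Proof.
transitivity #|rowg (kermx M^T)|; last by rewrite card_rowg mxrank_ker mxrank_tr.
rewrite -(card_imset _ (can_inj (@rVnpolyK F k))); apply: eq_card => Y.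
apply/idP/imsetP => [/eqP MY0|[v]].
  exists (npoly_rV Y); last by rewrite npoly_rV_K.
  rewrite inE; apply/sub_kermxP; apply: trmx_inj.
  by rewrite trmx_mul trmxK MY0 trmx0.
by rewrite inE => /sub_kermxP vM ->; rewrite inE rVnpolyK -[M]trmxK -trmx_mul vM trmx0.
Qed.

Lemma addlE (x y : laurent) n : (x + y) n = x n + y n. Proof. by []. Qed.
Lemma opplE (x : laurent) n : (- x) n = - x n. Proof. by []. Qed.

Lemma coef_mul_poly (x : laurent) (P : {poly 'F_2}) (m : nat) (n : int) :
  (size P <= m)%N -> (x * P%:L) n = \sum_(j < m) x (n - j%:Z) * P`_j.
Proof.
move=> sP; rewrite -[x * P%:L]/(mull x P%:L) /= /convl.
pose r := [seq n - j%:Z | j : nat <- iota 0 m].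
rewrite -(@fsbig_widen _ _ _ _ [set` r]) => [||i /= [_ ir]] //.
  rewrite -fsbig_seq; last by rewrite map_inj_uniq ?iota_uniq // => i j; lia.
  rewrite big_map -[X in iota 0 X]subn0 -/(index_iota 0 m) big_mkord.
  by apply: eq_bigr => j _; rewrite subKr.
case n_i : (n - i) => [j|j]; last by rewrite mulr0.
rewrite nth_default ?mulr0 //; apply: (leq_trans sP); rewrite leqNgt.
apply/negP => jm; apply: ir; apply/mapP; exists j; first by rewrite mem_iota.
by lia.
Qed.

Fact laurent_of_poly_is_zmod_morphism : zmod_morphism laurent_of_poly.
Proof.
by move=> P Q; apply: laurent_ext => -[j|j]; rewrite addlE opplE /= ?coefB ?subr0.
Qed.

Fact laurent_of_poly_is_monoid_morphism : monoid_morphism laurent_of_poly.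
Proof.
split=> [|P Q]; apply: laurent_ext => -[j|j] //; first by rewrite /= coef1.
  rewrite (coef_mul_poly _ _ (m := maxn (size Q) j.+1)) ?leq_maxl //=.
  rewrite coefMr (big_ord_widen _ (fun i => P`_(j - i) * Q`_i) (leq_maxr (size Q) _)).
  rewrite big_mkcond; apply: eq_bigr => i _; rewrite ltnS.
  case: leqP => [ij|ji]; first by rewrite subzn.
  by rewrite (_ : j%:Z - i%:Z = Negz (i - j.+1)) ?mul0r //; lia.
rewrite (coef_mul_poly _ _ (leqnn _)) /= big1 // => i _.
by rewrite (_ : Negz j - i%:Z = Negz (j + i)) ?mul0r //; lia.
Qed.

HB.instance Definition _ := GRing.isZmodMorphism.Build {poly 'F_2} laurent
  laurent_of_poly laurent_of_poly_is_zmod_morphism.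
HB.instance Definition _ := GRing.isMonoidMorphism.Build {poly 'F_2} laurent
  laurent_of_poly laurent_of_poly_is_monoid_morphism.

Definition frac_coef (t : laurent) (l : nat) : 'F_2 := t (-1 - l%:Z).

(* As [Negz l] is -1 - l, [frac_laurent a] is a_0 T^-1 + a_1 T^-2 + ... *)
Fact frac_laurent_subproof (a : {poly 'F_2}) :
  exists n, deg_le (fun i => if i is Negz l then a`_l else 0) n.
Proof. by exists (-1) => -[l|l] //; lia. Qed.
Definition frac_laurent (a : {poly 'F_2}) : laurent := Laurent (frac_laurent_subproof a).

Lemma frac_laurentK (a : {poly 'F_2}) : frac_coef (frac_laurent a) = nth 0 a.
Proof. by apply/funext => l; rewrite /frac_coef (_ : -1 - l%:Z = Negz l) //; lia. Qed.

Lemma frac_coef_mul_poly (t : laurent) (P : {poly 'F_2}) (m l : nat) :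
  (size P <= m)%N ->
  frac_coef (t * P%:L) l = \sum_(j < m) frac_coef t (l + j) * P`_j.
Proof.
move=> Pm; rewrite [LHS](coef_mul_poly _ _ Pm); apply: eq_bigr => j _.
by congr (t _ * _); lia.
Qed.

Section CharacterSums.
Variable R : realType.

Lemma charE0 : charE R 0 = 1. Proof. by []. Qed.

Lemma charED : {morph charE R : x y / x + y >-> x * y}.
Proof. by move=> x y; rewrite /charE -exprD -signr_odd -[RHS]signr_odd /= odd_mod. Qed.

Lemma charE_sum (I : Type) (r : seq I) (P : pred I) (F : I -> laurent) :
  charE R (\sum_(i <- r | P i) F i) = \prod_(i <- r | P i) charE R (F i).
Proof. exact: (big_morph _ charED charE0). Qed.

Lemma charE_frac_coef (x : laurent) : charE R x = (-1) ^+ (frac_coef x 0 : nat).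
Proof. by rewrite /charE /frac_coef subr0. Qed.

Lemma charE_eq1 (x : laurent) : (charE R x == 1) = (frac_coef x 0 == 0).
Proof.
rewrite charE_frac_coef; case: (frac_coef x 0) => -[|[|//]] ? /=; first exact: eqxx.
by rewrite expr1 eqNr oner_eq0.
Qed.

Lemma sum_charE_npoly (n : nat) (t : laurent) :
  \sum_(Z : {poly_n 'F_2}) charE R (t * Z%:L) =
  2 ^+ n * [forall j : 'I_n, frac_coef t j == 0]%:R.
Proof.
rewrite sum_character => [|Y Z]; last by rewrite /= rmorphD mulrDr charED.
rewrite card_npoly card_Fp // natrX; congr (_ * (nat_of_bool _)%:R).
under eq_forallb => Z do rewrite charE_eq1 (frac_coef_mul_poly _ _ (size_npoly Z)).
apply/forallP/forallP => [tZ0 j|t0 Z]; last first.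
  by rewrite big1 // => j _; rewrite (eqP (t0 j)) mul0r.
have := tZ0 (tnth (npolyX _ n) j).
rewrite npolyXE (bigD1 j) //= coefXn eqxx mulr1 big1 ?addr0 // => i.
by move=> /negbTE ij; rewrite coefXn (inj_eq val_inj) ij mulr0.
Qed.

Lemma charE_frac_laurentC (a P : {poly 'F_2}) :
  charE R (frac_laurent a * P%:L) = charE R (frac_laurent P * a%:L).
Proof.
rewrite !charE_frac_coef; congr (_ ^+ nat_of_ord _).
rewrite (frac_coef_mul_poly _ _ (leq_maxl (size P) (size a))).
rewrite (frac_coef_mul_poly _ _ (leq_maxr (size P) (size a))).
by apply: eq_bigr => l _; rewrite !frac_laurentK mulrC.
Qed.

Lemma sum_charE_frac_laurent (n : nat) (P : {poly 'F_2}) : (size P <= n)%N ->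
  \sum_(a : {poly_n 'F_2}) charE R (frac_laurent a * P%:L) = 2 ^+ n * (P == 0)%:R.
Proof.
move=> Pn; under eq_bigr do rewrite charE_frac_laurentC.
rewrite sum_charE_npoly; congr (_ * (nat_of_bool _)%:R).
under eq_forallb do rewrite frac_laurentK.
apply/forallP/eqP => [P0|-> j]; last by rewrite coef0.
apply/polyP => j; rewrite coef0; have [jn|nj] := ltnP j n; last first.
  by rewrite nth_default // (leq_trans Pn).
exact/eqP/(P0 (Ordinal jn)).
Qed.

End CharacterSums.

Definition hankel (R : Type) (s k : nat) (a : nat -> R) : 'M[R]_(s, k) :=
  \matrix_(i, j) a (i + j)%N.

Definition hankel3 (R : Type) (s k : nat) (a b c : nat -> R) : 'M[R]_(s + (s + s), k) :=
  col_mx (hankel s k a) (col_mx (hankel s k b) (hankel s k c)).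

Lemma eq_hankel (R : Type) (s k : nat) (a b : nat -> R) :
  (forall l, (l < (k + s).-1)%N -> a l = b l) -> hankel s k a = hankel s k b.
Proof.
move=> ab; apply/matrixP => i j; rewrite !mxE ab //.
by have := ltn_ord i; have := ltn_ord j; lia.
Qed.

Lemma hankel_mul_npoly (s k : nat) (t : laurent) (Y : {poly_k 'F_2}) :
  hankel s k (frac_coef t) *m (npoly_rV Y)^T = \col_j frac_coef (t * Y%:L) j.
Proof.
apply/colP => j; rewrite !mxE (frac_coef_mul_poly _ _ (size_npoly Y)).
by apply: eq_bigr => i _; rewrite !mxE.
Qed.

Section GFunction.
Variables (R : realType) (k s : nat).
Implicit Types t eta xi : laurent.

Lemma gE t eta xi :
  g R k s t eta xi = \sum_(Y : {poly_k 'F_2})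
    (\sum_(Z : {poly_s 'F_2}) charE R (t * Y%:L * Z%:L)) *
    (\sum_(U : {poly_s 'F_2}) charE R (eta * Y%:L * U%:L)) *
    (\sum_(V : {poly_s 'F_2}) charE R (xi * Y%:L * V%:L)).
Proof. by apply: eq_bigr => Y _; rewrite -mulr_suml -mulr_suml mulrA. Qed.

Lemma sum_charE_hankel t (Y : {poly_k 'F_2}) :
  \sum_(Z : {poly_s 'F_2}) charE R (t * Y%:L * Z%:L) =
  2 ^+ s * (hankel s k (frac_coef t) *m (npoly_rV Y)^T == 0)%:R.
Proof.
rewrite sum_charE_npoly hankel_mul_npoly; congr (_ * (nat_of_bool _)%:R).
apply/forallP/eqP => [tY0|/colP tY0 j].
  by apply/colP => j; rewrite !mxE (eqP (tY0 j)).
by have := tY0 j; rewrite !mxE => ->.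
Qed.

Lemma g_rank t eta xi :
  g R k s t eta xi = 2 ^+ (3 * s + (k - \rank (hankel3 s k (frac_coef t)
    (frac_coef eta) (frac_coef xi)))).
Proof.
rewrite gE exprD -[2 ^+ (k - _)]natrX -[X in (X ^ _)%N](card_Fp (isT : prime 2)).
rewrite -card_npoly_kernel -sum1_card natr_sum mulr_sumr [RHS]big_mkcond.
apply: eq_bigr => Y _; rewrite !sum_charE_hankel inE /= !mul_col_mx !col_mx_eq0.
rewrite mulnC exprM; case: (_ == 0); case: (_ == 0); case: (_ == 0) => /=; ring.
Qed.

Lemma eq_g t eta xi t' eta' xi' :
  (forall l, (l < (k + s).-1)%N -> frac_coef t l = frac_coef t' l) ->
  (forall l, (l < (k + s).-1)%N -> frac_coef eta l = frac_coef eta' l) ->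
  (forall l, (l < (k + s).-1)%N -> frac_coef xi l = frac_coef xi' l) ->
  g R k s t eta xi = g R k s t' eta' xi'.
Proof.
move=> tt' etaeta' xixi'; rewrite !g_rank /hankel3.
by rewrite (eq_hankel tt') (eq_hankel etaeta') (eq_hankel xixi').
Qed.

End GFunction.

Definition dotp (A : nzRingType) (q m n : nat) (Y : {ffun 'I_q -> {poly_m A}})
    (Z : {ffun 'I_q -> {poly_n A}}) : {poly A} := \sum_i (Y i : {poly A}) * Z i.

Lemma size_dotp (A : nzRingType) (q m n : nat) (Y : {ffun 'I_q -> {poly_m A}})
    (Z : {ffun 'I_q -> {poly_n A}}) : (size (dotp Y Z) <= (m + n).-1)%N.
Proof.
apply: (leq_trans (size_sum _ _ _)); apply/bigmax_leqP => i _.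
apply: (leq_trans (size_polyMleq _ _)).
by have := size_npoly (Y i); have := size_npoly (Z i); lia.
Qed.

Section CountSolutions.
Variables (R : realType) (q k s : nat).
Local Notation N := (k + s).-1.
Local Notation kvec := {ffun 'I_q -> {poly_k 'F_2}}.
Local Notation svec := {ffun 'I_q -> {poly_s 'F_2}}.

Definition num_orthogonal (Y : kvec) : nat := #|[pred Z : svec | dotp Y Z == 0]|.

Lemma num_solutionsE :
  num_solutions q k s = (\sum_(Y : kvec) num_orthogonal Y ^ 3)%N.
Proof.
transitivity (\sum_(Y : kvec) \sum_(Z : svec) \sum_(U : svec) \sum_(V : svec)
    [&& dotp Y Z == 0, dotp Y U == 0 & dotp Y V == 0]%R)%N.
  rewrite /num_solutions !pair_bigA -sum1_card big_mkcond.
  by apply: eq_bigr => -[[[Y Z] U] V] _; rewrite inE /dotp /=; case: (_ && _).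
apply: eq_bigr => Y _; rewrite /num_orthogonal -sum1_card [in RHS]big_mkcond.
rewrite !expnS muln1 big_distrl.
apply: eq_bigr => Z _; rewrite big_distrlr big_distrr.
apply: eq_bigr => U _; rewrite big_distrr; apply: eq_bigr => V _.
by rewrite !inE; case: (_ == 0); case: (_ == 0); case: (_ == 0).
Qed.

Lemma prod_sum_charE (t : laurent) (Y : kvec) :
  \prod_i \sum_(P : {poly_s 'F_2}) charE R (t * (Y i)%:L * P%:L) =
  \sum_(Z : svec) charE R (t * (dotp Y Z)%:L).
Proof.
rewrite bigA_distr_bigA; apply: eq_bigr => Z _; rewrite -charE_sum rmorph_sum mulr_sumr.
by congr charE; apply: eq_bigr => i _; rewrite rmorphM mulrA.
Qed.

Lemma sum_frac_laurent_charE_dotp (Y : kvec) :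
  \sum_(a : {poly_N 'F_2}) \sum_(Z : svec) charE R (frac_laurent a * (dotp Y Z)%:L) =
  2 ^+ N * (num_orthogonal Y)%:R.
Proof.
rewrite exchange_big /num_orthogonal -sum1_card natr_sum mulr_sumr [RHS]big_mkcond.
apply: eq_bigr => Z _.
by rewrite sum_charE_frac_laurent ?size_dotp // inE; case: (_ == 0); rewrite ?mulr0.
Qed.

Lemma sum_gX :
  \sum_(x : {poly_N 'F_2} * {poly_N 'F_2} * {poly_N 'F_2})
    g R k s (frac_laurent x.1.1) (frac_laurent x.1.2) (frac_laurent x.2) ^+ q =
  2 ^+ (3 * N) * (num_solutions q k s)%:R.
Proof.
under eq_bigr => x _.
  rewrite gE -[q in _ ^+ q]card_ord -prodr_const bigA_distr_bigA /=.
  under eq_bigr do rewrite !big_split /= !prod_sum_charE.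
  over.
rewrite exchange_big num_solutionsE natr_sum mulr_sumr; apply: eq_bigr => Y _.
pose S (a : {poly_N 'F_2}) := \sum_(Z : svec) charE R (frac_laurent a * (dotp Y Z)%:L).
rewrite -(big_distr_triple S S S) !sum_frac_laurent_charE_dotp.
by rewrite natrX mulnC exprM; ring.
Qed.

End CountSolutions.

Lemma persymmetricP (m n : nat) (M : 'M['F_2]_(m, n)) :
  reflect (forall (i : 'I_m) (j : 'I_n) (i' : 'I_m) (j' : 'I_n),
             (i + j = i' + j')%N -> M i j = M i' j') (persymmetric M).
Proof.
apply: (iffP 'forall_'forall_'forall_'forall_implyP) => pM i j i' j' /eqP ij.
  exact/eqP/pM.
exact/eqP/pM.
Qed.

Lemma persymmetric_hankel (s k : nat) (a : nat -> 'F_2) : persymmetric (hankel s k a).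
Proof. by apply/persymmetricP => i j i' j' ij; rewrite !mxE ij. Qed.

(* The antidiagonal i + j = l is read at row min(l, s): row s is the last one. *)
Definition antidiag (R : nzSemiRingType) (s k : nat) (M : 'M[R]_(s.+1, k.+1)) :
    {poly_(k.+1 + s.+1).-1 R} :=
  npolyp _ (\poly_(l < (k.+1 + s.+1).-1) M (inord (minn l s)) (inord (l - minn l s))).

Lemma coef_antidiag (R : nzSemiRingType) (s k : nat) (M : 'M[R]_(s.+1, k.+1)) l :
  (l < (k.+1 + s.+1).-1)%N ->
  (antidiag M)`_l = M (inord (minn l s)) (inord (l - minn l s)).
Proof. by move=> lN; rewrite coef_npolyp lN coef_poly lN. Qed.

Lemma hankel_antidiag (s k : nat) (M : 'M['F_2]_(s.+1, k.+1)) :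
  persymmetric M -> hankel s.+1 k.+1 (nth 0 (antidiag M)) = M.
Proof.
move=> /persymmetricP pM; apply/matrixP => i j; rewrite mxE.
have [si kj] := (ltn_ord i, ltn_ord j).
by rewrite coef_antidiag; [apply: pM; rewrite !inordK|]; lia.
Qed.

Lemma antidiag_hankel (R : nzSemiRingType) (s k : nat)
    (a : {poly_(k.+1 + s.+1).-1 R}) :
  antidiag (hankel s.+1 k.+1 (nth 0 a)) = a.
Proof.
apply/npolyP => l; have [lN|Nl] := ltnP l (k.+1 + s.+1).-1; last first.
  by rewrite !big_coef_npoly.
by rewrite coef_antidiag // mxE !inordK; [congr nth| |]; lia.
Qed.

Section RankDistribution.
Variables (s k : nat).
Hypotheses (s_gt0 : (0 < s)%N) (k_gt0 : (0 < k)%N).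
Local Notation N := (k + s).-1.

Definition persymmetric3 (M : 'M['F_2]_(s + (s + s), k)) : bool :=
  [&& persymmetric (usubmx M), persymmetric (usubmx (dsubmx M)) &
      persymmetric (dsubmx (dsubmx M))].

Lemma hankel3_bij :
  {on persymmetric3, bijective (fun x : {poly_N 'F_2} * {poly_N 'F_2} * {poly_N 'F_2} =>
    hankel3 s k (nth 0 x.1.1) (nth 0 x.1.2) (nth 0 x.2))}.
Proof.
rewrite /persymmetric3; case: s k s_gt0 k_gt0 => [//|s'] [//|k'] _ _.
exists (fun M => (antidiag (usubmx M), antidiag (usubmx (dsubmx M)),
  antidiag (dsubmx (dsubmx M)))) => [[[a b] c] _|M /and3P[pers_a pers_b pers_c]] /=.
  by rewrite /hankel3 !(col_mxKu, col_mxKd) !antidiag_hankel.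
by rewrite /hankel3 !hankel_antidiag // !vsubmxK.
Qed.

Lemma sum_rank_hankel3 (R : pzSemiRingType) (f : nat -> R) :
  \sum_(x : {poly_N 'F_2} * {poly_N 'F_2} * {poly_N 'F_2})
     f (\rank (hankel3 s k (nth 0 x.1.1) (nth 0 x.1.2) (nth 0 x.2))) =
  \sum_(0 <= i < (minn (3 * s) k).+1) (Gamma s k i)%:R * f i.
Proof.
transitivity (\sum_(M | persymmetric3 M) f (\rank M)).
  rewrite (reindex _ hankel3_bij); apply: eq_bigl => x; apply/esym.
  by rewrite /persymmetric3 /hankel3 !(col_mxKu, col_mxKd) !persymmetric_hankel.
rewrite (partition_big_nat (n := (minn (3 * s) k).+1)) => [|M _].
  apply: eq_big_nat => i _; congr (_%:R * _); apply: eq_card => M.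
  by rewrite !inE /persymmetric3 -!andbA.
by have := rank_leq_row M; have := rank_leq_col M; lia.
Qed.

End RankDistribution.

Lemma setT_enum (I : finType) : [set: I] = [set` enum I].
Proof. by apply/seteqP; split=> i //= _; rewrite mem_enum. Qed.

Lemma integral_bigcup_cst (d : measure_display) (T : measurableType d) (R : realType)
    (mu : {measure set T -> \bar R}) (I : finType) (F : I -> set T) (f : T -> R)
    (c : I -> R) :
  (forall i, measurable (F i)) -> trivIset setT F ->
  (forall i x, F i x -> f x = c i) ->
  (\int[mu]_(x in \bigcup_i F i) (f x)%:E = \sum_i (c i)%:E * mu (F i))%E.
Proof.
move=> mF tF fc; have mFr r : measurable (\big[setU/set0]_(i <- r) F i).
  exact: bigsetU_measurable.
rewrite setT_enum bigcup_seq integral_bigsetU_EFin ?enum_uniq -?setT_enum //.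
  rewrite big_enum /=; apply: eq_bigr => i _; rewrite -integral_cst //.
  by apply: eq_integral => x; rewrite inE => /fc->.
elim: (enum I) => [|i r mfr]; first by rewrite big_nil; exact: measurable_fun_set0.
rewrite big_cons; apply/measurable_funU => //; split; last exact: mfr.
apply/measurable_EFinP; apply: (eq_measurable_fun (cst (c i))) => [x|].
  by rewrite inE => /fc.
exact: measurable_cst.
Qed.

Lemma measure_bigcup_fintype (d : measure_display) (T : measurableType d) (R : realType)
    (mu : {measure set T -> \bar R}) (I : finType) (F : I -> set T) :
  (forall i, measurable (F i)) -> trivIset setT F ->
  mu (\bigcup_i F i) = (\sum_i mu (F i))%E.
Proof.
move=> mF tF; rewrite measure_fin_bigcup //; last exact: finite_finset.
by rewrite setT_enum -fsbig_seq ?enum_uniq // big_enum.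
Qed.

Lemma setX_bigcup (T1 T2 I J : Type) (F : I -> set T1) (G : J -> set T2) :
  (\bigcup_i F i) `*` (\bigcup_j G j) = \bigcup_p (F p.1 `*` G p.2).
Proof.
rewrite setX_bigcupl -setXTT (bigcup_setX (fun i j => F i `*` G j)).
by apply: eq_bigcupr => i _; rewrite setX_bigcupr.
Qed.

Lemma trivIset_setX (T1 T2 I J : Type) (F : I -> set T1) (G : J -> set T2) :
  trivIset setT F -> trivIset setT G -> trivIset setT (fun p => F p.1 `*` G p.2).
Proof.
move=> tF tG [i j] [i' j'] _ _ [[x y] [[Fx Gy] [Fx' Gy']]].
by congr (_, _); [apply: tF => //; exists x|apply: tG => //; exists y].
Qed.

Definition degree_ball (x : laurent) (n : int) : set laurent :=
  [set t : laurent | deg_le (t - x) n].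

Lemma measurable_degree_ball x n : measurable (degree_ball x n).
Proof.
suff : laurent_open (degree_ball x n) by exact: sub_sigma_algebra.
move=> t tx; exists n => u ut i ni.
by rewrite -(subrKA t) addlE ut // tx // addr0.
Qed.

Lemma degree_ball_translate x n :
  degree_ball x n = (fun t => x + t) @` degree_ball 0 n.
Proof.
apply/seteqP; split=> [t tx|_ [t t0 <-]]; last first.
  by move: t0; rewrite /degree_ball /mkset subr0 [x + t]addrC addrK.
by exists (t - x); rewrite /degree_ball /mkset ?subr0 // addrC subrK.
Qed.

Lemma frac_coef_degree_ball (x t : laurent) (n : nat) :
  degree_ball x (-1 - n%:Z) t ->
  forall l, (l < n)%N -> frac_coef t l = frac_coef x l.
Proof.
move=> tx l ln; apply/eqP; rewrite -subr_eq0 -opplE -addlE.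
by apply/eqP/tx; lia.
Qed.

Section Cosets.
Variable n : nat.

Definition coset_ball (a : {poly_n 'F_2}) : set laurent :=
  degree_ball (frac_laurent a) (-1 - n%:Z).

Lemma bigcup_coset_ball : \bigcup_a coset_ball a = unit_itv.
Proof.
apply/seteqP; split=> [t [a _ ta] i i0|t t1].
  rewrite -[t](subrK (frac_laurent a)) addlE ta ?add0r; last by lia.
  by case: i i0 => //=; lia.
exists (npolyp n (\poly_(l < n) frac_coef t l)) => // -[l|l] li.
  by rewrite addlE opplE /= t1 ?subr0 //; lia.
have ln : (l < n)%N by lia.
rewrite addlE opplE /= coef_npolyp ln coef_poly ln /frac_coef.
by rewrite (_ : -1 - l%:Z = Negz l) ?subrr //; lia.
Qed.

Lemma trivIset_coset_ball : trivIset setT coset_ball.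
Proof.
move=> a b _ _ [t [ta tb]]; apply/npolyP => l.
have [ln|nl] := ltnP l n; last by rewrite !big_coef_npoly.
rewrite -!frac_laurentK -(frac_coef_degree_ball ta) //.
by rewrite -(frac_coef_degree_ball tb).
Qed.

Lemma haar_coset_ball (R : realType) (mu : {measure set laurent -> \bar R})
    (a : {poly_n 'F_2}) :
  normalized_haar mu -> mu (coset_ball a) = (2 ^- n)%:E.
Proof.
move=> [muD mu1].
have mu_coset b : mu (coset_ball b) = mu (degree_ball 0 (-1 - n%:Z)).
  by rewrite /coset_ball degree_ball_translate muD //; exact: measurable_degree_ball.
have : (\sum_(b : {poly_n 'F_2}) mu (coset_ball b))%E = 1%E.
  rewrite -mu1 -bigcup_coset_ball measure_bigcup_fintype //.
    by move=> b; exact: measurable_degree_ball.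
  exact: trivIset_coset_ball.
rewrite mu_coset; under eq_bigr do rewrite mu_coset.
(* The iterated sum of the ring hierarchy is convertible to that of extended reals. *)
rewrite sumr_const -[LHS]/(_ *+ _)%E -mule_natl card_npoly card_Fp // natrX => mu_ball.
apply/esym/eqP; rewrite -[X in X == _]mule1.
by rewrite eqe_pdivrMl ?expf_neq0 ?pnatr_eq0 // mu_ball.
Qed.

End Cosets.

Section TripleIntegral.
Variables (R : realType) (mu : {sigma_finite_measure set laurent -> \bar R}) (n : nat).
Hypothesis haar_mu : normalized_haar mu.
Local Notation A := {poly_n 'F_2}.

Definition coset_ball3 (x : A * A * A) : set (laurent * laurent * laurent) :=
  coset_ball x.1.1 `*` coset_ball x.1.2 `*` coset_ball x.2.

Lemma measurable_coset_ball3 x : measurable (coset_ball3 x).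
Proof. by do 2?apply: measurableX; exact: measurable_degree_ball. Qed.

Lemma bigcup_coset_ball3 : \bigcup_x coset_ball3 x = unit_itv `*` unit_itv `*` unit_itv.
Proof.
rewrite -(bigcup_coset_ball n) setX_bigcup.
by rewrite (setX_bigcup (fun p : A * A => coset_ball p.1 `*` coset_ball p.2)).
Qed.

Lemma trivIset_coset_ball3 : trivIset setT coset_ball3.
Proof.
apply: (trivIset_setX (F := fun p : A * A => coset_ball p.1 `*` coset_ball p.2));
  last exact: trivIset_coset_ball.
by apply: trivIset_setX; exact: trivIset_coset_ball.
Qed.

Lemma haar_coset_ball3 x : ((mu \x mu \x mu) (coset_ball3 x) = (2 ^- (3 * n))%:E)%E.
Proof.
have mcoset a : measurable (coset_ball a) by exact: measurable_degree_ball.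
have haar_pair :
    ((mu \x mu) (coset_ball x.1.1 `*` coset_ball x.1.2) = (2 ^- n * 2 ^- n)%:E)%E.
  by rewrite product_measure1E // !haar_coset_ball // EFinM.
have -> : 2 ^- (3 * n) = 2 ^- n * 2 ^- n * 2 ^- n :> R.
  by rewrite mulnC exprM -exprVn; ring.
rewrite [LHS]product_measure1E //; last exact: measurableX.
by rewrite EFinM; congr mule; [exact: haar_pair|exact: haar_coset_ball].
Qed.

Lemma integral_coset_ball3_cst (f : laurent * laurent * laurent -> R)
    (c : A * A * A -> R) :
  (forall x p, coset_ball3 x p -> f p = c x) ->
  (\int[mu \x mu \x mu]_(p in unit_itv `*` unit_itv `*` unit_itv) (f p)%:E =
   (2 ^- (3 * n) * \sum_x c x)%:E)%E.
Proof.
move=> fc; rewrite -bigcup_coset_ball3.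
rewrite (integral_bigcup_cst _ measurable_coset_ball3 trivIset_coset_ball3 fc).
rewrite mulr_sumr -sumEFin; apply: eq_bigr => x _.
by rewrite mulrC EFinM; congr mule; exact: haar_coset_ball3.
Qed.

End TripleIntegral.

Lemma integral_gX (R : realType) (mu : {sigma_finite_measure set laurent -> \bar R})
    (k s q : nat) : normalized_haar mu ->
  (\int[mu \x mu \x mu]_(x in unit_itv `*` unit_itv `*` unit_itv)
       ((g R k s x.1.1 x.1.2 x.2) ^+ q)%:E =
   (2 ^- (3 * (k + s).-1) *
    \sum_(x : {poly_(k + s).-1 'F_2} * {poly_(k + s).-1 'F_2} * {poly_(k + s).-1 'F_2})
      g R k s (frac_laurent x.1.1) (frac_laurent x.1.2) (frac_laurent x.2) ^+ q)%R%:E)%E.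
Proof.
move=> haar_mu; apply: integral_coset_ball3_cst => // x p [[x_t x_eta] x_xi].
by congr (_ ^+ q); apply: eq_g; apply: frac_coef_degree_ball.
Qed.

Theorem theorem3p4 (R : realType) (mu : {sigma_finite_measure set laurent -> \bar R})
    (k s q : nat) :
  normalized_haar mu -> (0 < k)%N -> (0 < s)%N -> (0 < q)%N ->
  ((num_solutions q k s)%:R%:E =
     \int[mu \x mu \x mu]_(x in unit_itv `*` unit_itv `*` unit_itv)
       ((g R k s x.1.1 x.1.2 x.2) ^+ q)%:E)%E /\
  (\int[mu \x mu \x mu]_(x in unit_itv `*` unit_itv `*` unit_itv)
       ((g R k s x.1.1 x.1.2 x.2) ^+ q)%:E =
    (2 ^+ ((3 * s + k) * q) * 2 ^ (- 3 * k%:Z - 3 * s%:Z + 3) *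
     (\sum_(0 <= i < (minn (3 * s) k).+1) (Gamma s k i)%:R * 2 ^- (q * i)))%:E)%E.
Proof.
move=> haar_mu k_gt0 s_gt0 _; rewrite integral_gX //; split.
  by rewrite sum_gX mulKf // expf_neq0 // pnatr_eq0.
congr EFin; under eq_bigr do rewrite g_rank !frac_laurentK.
rewrite (sum_rank_hankel3 s_gt0 k_gt0 (fun i => (2 ^+ (3 * s + (k - i))) ^+ q)).
have two_neq0 : (2 : R) != 0 by rewrite pnatr_eq0.
rewrite !mulr_sumr; apply: eq_big_nat => i /andP[_ i_le].
rewrite mulrCA [RHS]mulrCA; congr (_ * _).
rewrite -exprM !exprnN !exprnP -!expfzDr //; congr (_ ^ _).
nia.
Qed.
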